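(* Let $\mathbf{L}=\mathbf{V}\boldsymbol{\Lambda}\mathbf{V}^\top$ be the Laplacian of the network $\mathcal{G}$, let $\mathbf{y}_k=\prod_{t=1}^{T_k}(\mathbf{I}-\alpha_t^{(k)}\mathbf{L})\,\mathbf{x}_k$ for $k=1,2,\ldots$ be the observed snapshots, and let $\mathbf{S}_M=\frac1M\sum_{k=1}^M\mathbf{y}_k\mathbf{y}_k^\top$ and $\mathbf{B}^{(M)}=\mathbf{V}^\top\mathbf{S}_M\mathbf{V}$, all as specified in the context. Then, for $M\to\infty$, the eigenbasis $\mathbf{V}$ diagonalizes $\mathbf{S}_M$, i.e., for all $i\neq j$ it holds that $$\lim_{M\to\infty}[\mathbf{V}^\top\mathbf{S}_M\mathbf{V}]_{ij}=\lim_{M\to\infty}B^{(M)}_{ij}=0.$$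
   Context: Network: $\mathcal{G}$ is a weighted undirected network on $N$ nodes with symmetric adjacency matrix $\mathbf{A}\in\mathbb{R}^{N\times N}$ with non-negative entries ($A_{ij}=A_{ji}\ne 0$ exactly on edges), and Laplacian $\mathbf{L}=\mathrm{diag}(\mathbf{A}\mathbf{1})-\mathbf{A}$, where $\mathbf{1}$ is the all-one vector. $\mathbf{L}$ is symmetric positive semi-definite, and its eigenvalues are assumed to be distinct: $0=\lambda_1<\lambda_2<\cdots<\lambda_N$. Write $\mathbf{L}=\mathbf{V}\boldsymbol{\Lambda}\mathbf{V}^\top$ with $\mathbf{V}$ a real orthogonal matrix and $\boldsymbol{\Lambda}=\mathrm{diag}(\lambda_1,\ldots,\lambda_N)$ (eigenvalues in increasing order). Observations: for each $k=1,2,\ldots$ there is a finite duration $T_k$ (a positive integer) and deterministic rates $\alpha_t^{(k)}$, $t=1,\ldots,T_k$, with $0<\alpha_t^{(k)}<1/\lambda_{\max}(\mathbf{L})$, where $\lambda_{\max}(\mathbf{L})=\lambda_N$. The durations and rates may differ across $k$ and $t$. The inputs $\mathbf{x}_1,\mathbf{x}_2,\ldots$ are independent random vectors, each distributed as $\mathcal{N}(\mathbf{0},\sigma^2\mathbf{I})$ in $\mathbb{R}^N$. The $k$th snapshot is $\mathbf{y}_k=\prod_{t=1}^{T_k}(\mathbf{I}-\alpha_t^{(k)}\mathbf{L})\,\mathbf{x}_k$. Sample covariance: $\mathbf{S}_M=\frac1M\sum_{k=1}^M\mathbf{y}_k\mathbf{y}_k^\top$, and $\mathbf{B}^{(M)}=\mathbf{V}^\top\mathbf{S}_M\mathbf{V}$.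 *)

(* Defs.v *)
From HB Require Import structures.
From mathcomp Require Import all_boot all_order all_algebra.
From mathcomp Require Import all_classical all_reals all_analysis.

Set Implicit Arguments.
Unset Strict Implicit.
Unset Printing Implicit Defensive.

Import Order.TTheory GRing.Theory Num.Theory.
Import numFieldNormedType.Exports.

Local Open Scope classical_set_scope.
Local Open Scope ring_scope.

(* The edges are the pairs (i, j) with a nonzero entry; self-loops are allowed
   (they cancel in the Laplacian). *)
Record network (R : numDomainType) (N : nat) := Network {
  adjacency : 'M[R]_N;
  adjacency_sym : adjacency^T = adjacency;
  adjacency_ge0 : forall i j, 0 <= adjacency i j
}.

Definition laplacian (R : numDomainType) (N : nat) (G : network R N) : 'M[R]_N :=
  diag_mx (adjacency G *m (const_mx 1 : 'cV[R]_N))^T - adjacency G.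

Definition orthogonal_mx (R : pzRingType) (N : nat) (V : 'M[R]_N) : Prop :=
  V^T *m V = 1%:M /\ V *m V^T = 1%:M.

(* R^N with its Borel sigma-algebra. *)
Definition borel_cV (R : realType) (N : nat) :=
  g_sigma_algebraType (@open 'cV[R]_N).

(* N(m, v) on the line, with v the variance.  The Dirac mass is needed at v = 0
   because [normal_prob m 0] is the uniform law on [0, 1]. *)
Definition normal_law (R : realType) (m v : R) (B : set R) : \bar R :=
  if v == 0 then \d_m B else normal_prob m (Num.sqrt v) B.

(* X is distributed as N(mu, Sigma) in R^N: X is a random vector all of whose
   linear forms <a, X> have law N(<a, mu>, a^T Sigma a). *)
Definition multivariate_normal (R : realType) (d : measure_display)
    (Omega : measurableType d) (P : probability Omega R) (N : nat)
    (mu : 'cV[R]_N) (Sigma : 'M[R]_N) (X : Omega -> 'cV[R]_N) : Prop :=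
  measurable_fun [set: Omega] (X : Omega -> borel_cV R N) /\
  forall (a : 'cV[R]_N) (B : set R), measurable B ->
    P [set w | B ((a^T *m X w) 0 0)] =
    normal_law ((a^T *m mu) 0 0) ((a^T *m Sigma *m a) 0 0) B.

Definition mutually_independent (R : realType) (d d' : measure_display)
    (Omega : measurableType d) (P : probability Omega R)
    (T : measurableType d') (I : choiceType) (X : I -> Omega -> T) : Prop :=
  forall (J : seq I) (B : I -> set T), uniq J ->
    (forall i, i \in J -> measurable (B i)) ->
    P (\bigcap_(i in [set` J]) (X i @^-1` B i)) =
    (\prod_(i <- J) P (X i @^-1` B i))%E.

Definition diffuse (R : pzRingType) (N : nat) (L : 'M[R]_N) (T : nat)
    (alpha : nat -> R) (x : 'cV[R]_N) : 'cV[R]_N :=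
  (\prod_(t < T) (1%:M - alpha t *: L)) *m x.

Definition sample_covariance (R : realType) (N : nat) (y : nat -> 'cV[R]_N)
    (M : nat) : 'M[R]_N :=
  M%:R^-1 *: \sum_(k < M) (y k *m (y k)^T).

(* Main.v *)
(* In the eigenbasis, [B_ij] is the average over the first M snapshots of
   [Z_k = c_k U_k W_k], where [U_k], [W_k] are the coordinates of [x_k] along the i-th
   and j-th columns of [V], and [0 <= c_k <= 1] is a product of factors
   [1 - alpha_t lambda].  Since [U_k + W_k] and [U_k - W_k] have the same law,
   polarisation gives [E Z_k = 0]; independence makes the [Z_k] pairwise
   uncorrelated, and finiteness of the Gaussian fourth moment bounds [E Z_k^2]
   uniformly in k.  Rajchman's strong law for uncorrelated variables with bounded
   second moments concludes, although the [Z_k] are not identically distributed. *)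
Require Import Defs.
From HB Require Import structures.
From mathcomp Require Import all_boot all_order all_algebra.
From mathcomp Require Import all_classical all_reals all_analysis.
From mathcomp Require Import measurable_realfun ring lra.

Set Implicit Arguments.
Unset Strict Implicit.
Unset Printing Implicit Defensive.

Import Order.TTheory GRing.Theory Num.Theory.
Import numFieldNormedType.Exports.

Local Open Scope classical_set_scope.
Local Open Scope ring_scope.

(** * Independence and the strong law *)

Lemma mutually_independent_pair (R : realType) (d d' : measure_display)
    (Omega : measurableType d) (P : probability Omega R)
    (T : measurableType d') (I : choiceType) (X : I -> Omega -> T) (k l : I)
    (A B : set T) :
    mutually_independent P X -> k != l -> measurable A -> measurable B ->
  P (X k @^-1` A `&` X l @^-1` B) = (P (X k @^-1` A) * P (X l @^-1` B))%E.
Proof.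
move=> indep kl mA mB.
pose C i := if i == k then A else B.
have Ck : C k = A by rewrite /C eqxx.
have Cl : C l = B by rewrite /C eq_sym (negbTE kl).
have := indep [:: k; l] C _ _.
rewrite !big_cons big_nil mule1 Ck Cl => <-.
- congr (P _); apply/seteqP; split=> w.
    move=> [Aw Bw] i /=; rewrite !inE => /orP[]/eqP->; first by rewrite Ck.
    by rewrite Cl.
  move=> h; split.
    by have := h k; rewrite /= !inE eqxx Ck; apply.
  by have := h l; rewrite /= !inE eqxx orbT Cl; apply.
- by rewrite /= inE kl.
- by move=> i _; rewrite /C; case: ifP.
Qed.

(** The joint law of [(X, Y)] agrees with the product of the two laws on rectangles, hence
    everywhere; Fubini then splits the integral. Independence is asked of [X] and [Y] rather than of
    [f \o X] and [g \o Y], because the theorem assumes it for random vectors and applies it to real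
    functions of them. *)
Lemma expectationM_indep d d1 d2 (T : measurableType d) (T1 : measurableType d1)
    (T2 : measurableType d2) (R : realType) (P : probability T R)
    (X : {mfun T >-> T1}) (Y : {mfun T >-> T2}) (f : T1 -> R) (g : T2 -> R) :
    (forall A B, measurable A -> measurable B ->
      P (X @^-1` A `&` Y @^-1` B) = (P (X @^-1` A) * P (Y @^-1` B))%E) ->
    measurable_fun [set: T1] f -> measurable_fun [set: T2] g ->
    f \o X \in Lfun P 1 -> g \o Y \in Lfun P 1 ->
    (f \o X) \* (g \o Y) \in Lfun P 1 ->
  ('E_P[(f \o X) \* (g \o Y)] = 'E_P[f \o X] * 'E_P[g \o Y])%E.
Proof.
move=> indep mf mg /Lfun1_integrable iX /Lfun1_integrable iY /Lfun1_integrable iXY.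
have mXY : measurable_fun [set: T] (fun w => (X w, Y w)).
  by apply/measurable_fun_pairP; split; exact: measurable_funPT.
pose XY : {mfun T >-> (T1 * T2)%type} := mfun_Sub (mem_set mXY).
pose h (z : T1 * T2) : \bar R := (f z.1 * g z.2)%:E.
have mh : measurable_fun setT h.
  by apply/measurable_EFinP; apply: measurable_funM; exact: measurableT_comp.
pose m := (distribution P X \x distribution P Y)%E.
have E (A : set (T1 * T2)) : measurable A -> distribution P XY A = m A.
  by move=> mA; rewrite [RHS](product_measure_unique _ (m' := distribution P XY)).
have iXYh : P.-integrable setT (h \o XY) by [].
have ih : (distribution P XY).-integrable setT h by exact: integrable_pushforward.
(* Fubini requires integrability against the product measure; it is inherited from the joint law,
   since the two measures coincide. *)
have imh : m.-integrable setT h.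
  apply/integrableP; split => //.
  move/integrableP : ih => [_]; apply: le_lt_trans.
  rewrite le_eqVlt; apply/orP; left; apply/eqP.
  by apply: eq_measure_integral => A mA _; exact/esym/E.
transitivity (\int[m]_z h z)%E.
  rewrite unlock -[LHS]/(\int[P]_(w in XY @^-1` setT) (h \o XY) w)%E.
  rewrite -(integral_pushforward mXY mh)//.
  by apply: eq_measure_integral => A mA _; exact: E.
have iX' : (distribution P X).-integrable setT (EFin \o f).
  by apply: integrable_pushforward => //; exact/measurable_EFinP.
have iY' : (distribution P Y).-integrable setT (EFin \o g).
  by apply: integrable_pushforward => //; exact/measurable_EFinP.
rewrite -integral12_prod_meas1// unlock.
have -> : fubini_F (distribution P Y) h =
    fun x => ((f x)%:E * \int[P]_w (g (Y w))%:E)%E.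
  apply/funext => x; rewrite /fubini_F /h/=.
  under eq_integral do rewrite EFinM.
  rewrite integralZl//=.
  by rewrite (integral_distribution (f := EFin \o g))//; exact/measurable_EFinP.
have -> : (\int[P]_w (g (Y w))%:E)%E = (fine (\int[P]_w (g (Y w))%:E))%:E.
  by rewrite fineK// integrable_fin_num.
rewrite integralZr//=.
by rewrite (integral_distribution (f := EFin \o f))//; exact/measurable_EFinP.
Qed.

(** * Averages controlled along perfect squares *)

Section rajchman.
Variable R : realType.
Implicit Types z : nat -> R.

Definition block_sum z (a r : nat) : R := \sum_(k < r) z (a + k)%N.

(* Square of the partial sum at [m.+1 ^ 2] plus the squares of all increments up to
   the next perfect square, normalised so that it controls every average
   taken between these two squares. *)
Definition block_energy z (m : nat) : R :=
  (block_sum z 0 (m.+1 ^ 2) ^+ 2 +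
   \sum_(r < m.+1.*2.+1) block_sum z (m.+1 ^ 2) r ^+ 2) / m.+1%:R ^+ 4.

Lemma block_sumS z a r : block_sum z a r.+1 = block_sum z a r + z (a + r)%N.
Proof. by rewrite /block_sum big_ord_recr. Qed.

Lemma block_sum_cat z a r :
  block_sum z 0 (a + r) = block_sum z 0 a + block_sum z a r.
Proof. by rewrite /block_sum big_split_ord. Qed.

Lemma block_energy_ge0 z m : 0 <= block_energy z m.
Proof.
apply: divr_ge0; last exact: exprn_ge0.
by apply: addr_ge0; [exact: sqr_ge0|apply: sumr_ge0 => i _; exact: sqr_ge0].
Qed.

(** Split the partial sum at the square as [s + t]. Then [(s + t)^2 <= 2 (s^2 + t^2)], where [t^2]
    is one of the summands of the energy, and the squared denominator is at least [m.+1 ^ 4]. *)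
Lemma sqr_average_le_energy z m r : (r < m.+1.*2.+1)%N ->
  ((m.+1 ^ 2 + r)%:R^-1 * block_sum z 0 (m.+1 ^ 2 + r)) ^+ 2 <=
  2 * block_energy z m.
Proof.
move=> rm; rewrite block_sum_cat exprMn exprVn /block_energy.
set s := block_sum z 0 _; set t := block_sum z _ r.
have tS : t ^+ 2 <= \sum_(r < m.+1.*2.+1) block_sum z (m.+1 ^ 2) r ^+ 2.
  rewrite (bigD1 (Ordinal rm))//= lerDl.
  by apply: sumr_ge0 => i _; exact: sqr_ge0.
rewrite mulrA mulrC; apply: ler_pM.
- exact: sqr_ge0.
- by rewrite invr_ge0 sqr_ge0.
- apply: (@le_trans _ _ (2 * (s ^+ 2 + t ^+ 2))).
    rewrite -subr_ge0; have -> : 2 * (s ^+ 2 + t ^+ 2) - (s + t) ^+ 2 = (s - t) ^+ 2.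
      by ring.
    exact: sqr_ge0.
  by rewrite ler_pM2l// lerD2l.
- have m0 : 0 < m.+1%:R :> R by rewrite ltr0n.
  have am : m.+1%:R ^+ 2 <= (m.+1 ^ 2 + r)%:R :> R.
    by rewrite -natrX ler_nat leq_addr.
  have a0 : 0 < (m.+1 ^ 2 + r)%:R :> R by apply: lt_le_trans am; exact: exprn_gt0.
  rewrite lef_pV2 ?posrE ?exprn_gt0// -[4%N]/((2 * 2)%N) exprM.
  by rewrite ler_pXn2r// nnegrE ltW// exprn_gt0.
Qed.

Lemma average_cvg0 z : block_energy z @ \oo --> (0 : R) ->
  (fun M => M%:R^-1 * \sum_(k < M) z k) @ \oo --> (0 : R).
Proof.
move=> /cvgrPdist_lt E0; apply/cvgrPdist_lt => e e0.
(* The squared average is at most twice the energy, so energy below [e^2 / 2] makes the average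
   smaller than [e]. *)
have e20 : 0 < e ^+ 2 / 2 by rewrite divr_gt0 ?exprn_gt0.
have [m0 _ m0E] := E0 _ e20.
exists (m0.+1 ^ 2)%N => // M /= m0M.
(* [m.+1] is the integer square root of [M]; maximality gives both the upper bound on [M] and
   [m0 <= m]. *)
have [m [m0m mM Mm]] : exists m, [/\ (m0 <= m)%N, (m.+1 ^ 2 <= M)%N & (M < m.+2 ^ 2)%N].
  have exP : exists n, (n.+1 ^ 2 <= M)%N by exists m0.
  have ubP n : (n.+1 ^ 2 <= M)%N -> (n <= M)%N.
    move=> nM; apply: ltnW; apply: leq_trans nM; by rewrite leq_pmulr.
  case: (ex_maxnP exP ubP) => m mM maxm; exists m; split => //.
    exact: maxm.
  by rewrite ltnNge; apply/negP => /maxm; rewrite ltnn.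
(* The gap between consecutive squares is [(m+2)^2 - (m+1)^2 = 2(m+1) + 1]. *)
have rm : (M - m.+1 ^ 2 < m.+1.*2.+1)%N.
  rewrite ltn_subLR//; apply: leq_trans Mm _.
  by rewrite -(addn1 m.+1) sqrnD muln1 exp1n mul2n -addnA [(1 + _)%N]addnC addnS addn0.
have := sqr_average_le_energy z rm; rewrite subnKC// => le2.
have := m0E m m0m; rewrite /= !sub0r !normrN ger0_norm ?block_energy_ge0// => Em.
have -> : \sum_(k < M) z k = block_sum z 0 M by [].
rewrite -(@ltr_pXn2r _ 2)// ?nnegrE// ?ltW// real_normK ?num_real//.
by apply: le_lt_trans le2 _; rewrite mulrC -ltr_pdivlMr.
Qed.
End rajchman.

(** * Second moments of sums of uncorrelated variables *)

Section uncorrelated.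
Context d (T : measurableType d) (R : realType) (P : probability T R).
Implicit Types (X Y : T -> R).

Lemma Lfun2D X Y : X \in Lfun P 2 -> Y \in Lfun P 2 -> X \+ Y \in Lfun P 2.
Proof. by have [_ +] := @Lfun_addr_closed _ T R P 2 (lee1n 2); apply. Qed.

Lemma expectation_sqrD X Y : X \in Lfun P 2 -> Y \in Lfun P 2 ->
  ('E_P[X \* Y] = 0)%E ->
  ('E_P[((X \+ Y) \* (X \+ Y))%R] = 'E_P[X \* X] + 'E_P[Y \* Y])%E.
Proof.
move=> X2 Y2 XY0.
have -> : (X \+ Y) \* (X \+ Y) = (X \* X \+ Y \* Y) \+ 2 \o* (X \* Y).
  by apply/funext => w /=; ring.
have XX := Lfun2_mul_Lfun1 X2 X2.
have YY := Lfun2_mul_Lfun1 Y2 Y2.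
have XY := Lfun2_mul_Lfun1 X2 Y2.
rewrite expectationD ?expectationD ?expectationZl ?XY0 ?mule0 ?adde0//.
- by have [_ +] := @Lfun_addr_closed _ T R P 1 (lexx _); apply.
- exact: Lfun_scale.
Qed.

Variables (Z : nat -> T -> R) (C : R).
Hypothesis Z2 : forall k, Z k \in Lfun P 2.
Hypothesis ZC : forall k, ('E_P[Z k \* Z k] <= C%:E)%E.
Hypothesis Z0 : forall k l, k != l -> ('E_P[Z k \* Z l] = 0)%E.

Let D a r w := block_sum (Z ^~ w) a r.

Let DS a r : D a r.+1 = D a r \+ Z (a + r)%N.
Proof. by apply/funext => w; rewrite /D block_sumS. Qed.

Let D0 a : D a 0 = cst 0.
Proof. by apply/funext => w; rewrite /D /block_sum big_ord0. Qed.

Let D2 a r : D a r \in Lfun P 2.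
Proof.
elim: r => [|r IH]; first by rewrite D0 Lfun_cst.
by rewrite DS Lfun2D.
Qed.

(** The block uses the indices from [a] to [a + r - 1] only, so [k] differs from all of them. *)
Let DZ a r k : (a + r <= k)%N -> ('E_P[D a r \* Z k] = 0)%E.
Proof.
elim: r => [|r IH] ark.
  rewrite D0 [X in ('E_P[X])%E](_ : _ = cst 0) ?expectation_cst//.
  by apply/funext => w /=; rewrite mul0r.
rewrite DS [X in ('E_P[X])%E](_ : _ = (D a r \* Z k) \+ (Z (a + r)%N \* Z k)); last first.
  by apply/funext => w /=; rewrite mulrDl.
rewrite expectationD ?Lfun2_mul_Lfun1// IH ?Z0 ?adde0//.
  by rewrite neq_ltn -addnS ark.
by rewrite (leq_trans _ ark)// leq_add2l.
Qed.

(** Pythagoras: each new term is orthogonal to the block before it and adds at most [C]. *)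
Lemma expectation_block_sum_sqr_le a r :
  ('E_P[(fun w => block_sum (Z ^~ w) a r ^+ 2)%R] <= (r%:R * C)%:E)%E.
Proof.
rewrite [X in ('E_P[X])%E](_ : _ = D a r \* D a r); last first.
  by apply/funext => w; rewrite /= expr2.
elim: r => [|r IH].
  rewrite D0 [X in ('E_P[X])%E](_ : _ = cst 0) ?expectation_cst ?mul0r//.
  by apply/funext => w /=; rewrite mul0r.
rewrite DS expectation_sqrD// ?DZ//.
by rewrite -natr1 mulrDl mul1r EFinD leeD.
Qed.

Lemma measurable_block_sum a r :
  measurable_fun setT (fun w => block_sum (Z ^~ w) a r).
Proof. by have := sub_Lfun_mfun (D2 a r); rewrite inE. Qed.

Lemma measurable_block_energy m :
  measurable_fun setT (fun w => block_energy (Z ^~ w) m).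
Proof.
apply: measurable_funM => //; apply: measurable_funD.
  by apply: measurable_funX; exact: measurable_block_sum.
by apply: measurable_sum => i; apply: measurable_funX; exact: measurable_block_sum.
Qed.

(** With [N = m.+1], the expected numerator is of order [N^2] while the denominator is [N^4]. The
    resulting decay in [1 / N^2] is what makes the energies summable over [m]. *)
Lemma expectation_block_energy_le m :
  ('E_P[(fun w => block_energy (Z ^~ w) m)%R] <= (10 * C / m.+1%:R ^+ 2)%:E)%E.
Proof.
have C0 : 0 <= C.
  rewrite -lee_fin; apply: le_trans (ZC 0); apply: expectation_ge0 => w /=.
  by rewrite -expr2 sqr_ge0.
have msq a r : measurable_fun setT (fun w => (block_sum (Z ^~ w) a r ^+ 2)%:E).
  by apply/measurable_EFinP/measurable_funX/measurable_block_sum.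
rewrite unlock.
under eq_integral do rewrite /block_energy mulrC EFinM EFinD -sumEFin.
rewrite ge0_integralZl//=; last 2 first.
- by apply: emeasurable_funD => //; exact: emeasurable_sum.
- move=> w _; rewrite adde_ge0 ?lee_fin ?sqr_ge0// sume_ge0// => i _.
  by rewrite lee_fin sqr_ge0.
rewrite ge0_integralD//=; last 3 first.
- by move=> w _; rewrite lee_fin sqr_ge0.
- by move=> w _; rewrite sume_ge0// => i _; rewrite lee_fin sqr_ge0.
- exact: emeasurable_sum.
rewrite ge0_integral_sum//=; last first.
  by move=> i w _; rewrite lee_fin sqr_ge0.
have E a r : (\int[P]_w (block_sum (Z ^~ w) a r ^+ 2)%:E <= (r%:R * C)%:E)%E.
  by have := expectation_block_sum_sqr_le a r; rewrite unlock.
set N := m.+1; have N1 : 1 <= N%:R :> R by rewrite ler1n.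
have N0 : 0 < N%:R :> R by rewrite ltr0n.
apply: (@le_trans _ _ ((N%:R ^+ 4)^-1%:E * ((N ^ 2)%:R * C + \sum_(r < N.*2.+1) r%:R * C)%:E))%E.
  rewrite lee_pmul2l ?lte_fin ?invr_gt0 ?exprn_gt0//.
  by rewrite EFinD -sumEFin leeD// lee_sum.
rewrite -EFinM lee_fin mulrC -(@ler_pM2r _ (N%:R ^+ 4)) ?exprn_gt0//.
rewrite divfK ?gt_eqF ?exprn_gt0//.
have -> : 10 * C / N%:R ^+ 2 * N%:R ^+ 4 = 10 * C * N%:R ^+ 2.
  by field; rewrite gt_eqF.
(* Each [r] is at most [2N], so the numerator is at most [C (N^2 + 2N (2N + 1)) = C (5 N^2 + 2 N)].
   Since [N <= N^2], this lies below [10 C N^2]. *)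
have : \sum_(r < N.*2.+1) r%:R * C <= \sum_(r < N.*2.+1) (N.*2)%:R * C.
  by apply: ler_sum => r _; rewrite ler_wpM2r// ler_nat -ltnS.
move=> /(lerD (lexx ((N ^ 2)%:R * C))) /le_trans; apply.
rewrite sumr_const card_ord -mulr_natl -natr1 -mul2n natrM natrX.
have : 0 <= C * (N%:R * (N%:R - 1)) by rewrite !mulr_ge0// subr_ge0.
have : 0 <= C * N%:R ^+ 2 by rewrite mulr_ge0// exprn_ge0.
nra.
Qed.

End uncorrelated.

Lemma sum_inv_sqr_le2 (R : realFieldType) n :
  \sum_(m < n) (m.+1%:R ^+ 2)^-1 <= 2 :> R.
Proof.
(* The correction [- 1 / k.+1] makes the induction go through:
   [1 / (x + 1)^2 <= 1 / x - 1 / (x + 1)]. *)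
have H k : \sum_(m < k.+1) (m.+1%:R ^+ 2)^-1 <= 2 - k.+1%:R^-1 :> R.
  elim: k => [|k IH]; first by rewrite big_ord1 expr1n invr1; lra.
  rewrite big_ord_recr/=; apply: le_trans (lerD IH (lexx _)) _.
  set x := k.+1%:R; have x0 : 0 < x :> R by rewrite ltr0n.
  rewrite -[k.+2%:R]natr1 -/x -subr_ge0.
  have -> : 2 - (x + 1)^-1 - (2 - x^-1 + ((x + 1) ^+ 2)^-1) = (x * (x + 1) ^+ 2)^-1.
    by field; rewrite !gt_eqF// addr_gt0.
  by rewrite invr_ge0 mulr_ge0 ?exprn_ge0 ?addr_ge0// ltW.
case: n => [|n]; first by rewrite big_ord0.
by apply: le_trans (H n) _; rewrite gerBl invr_ge0.
Qed.

(** The energies have a finite expected sum, so almost surely their series converges and they tend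
    to 0. At each such point [average_cvg0] applies, with no probability left. *)
Lemma rajchman_slln d (T : measurableType d) (R : realType)
    (P : probability T R) (Z : nat -> T -> R) (C : R) :
    (forall k, Z k \in Lfun P 2) ->
    (forall k, ('E_P[Z k \* Z k] <= C%:E)%E) ->
    (forall k l, k != l -> ('E_P[Z k \* Z l] = 0)%E) ->
  {ae P, forall w, (fun M => M%:R^-1 * \sum_(k < M) Z k w) @ \oo --> (0 : R)}.
Proof.
move=> Z2 ZC Z0.
pose F m w := (block_energy (Z ^~ w) m)%:E.
have F0 m w : (0 <= F m w)%E by rewrite lee_fin block_energy_ge0.
have mF m : measurable_fun setT (F m).
  by apply/measurable_EFinP; exact: measurable_block_energy.
have C0 : 0 <= C.
  rewrite -lee_fin; apply: le_trans (ZC 0); apply: expectation_ge0 => w /=.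
  by rewrite -expr2 sqr_ge0.
have sumF_lty : (\int[P]_w (\sum_(m <oo) F m w) < +oo)%E.
  rewrite integral_nneseries//.
  (* [20 C] is the factor [10 C] of the energy bound times the bound 2 on the sum of inverse
     squares. *)
  apply: (@le_lt_trans _ _ (20 * C)%:E); last exact: ltry.
  apply: lime_le.
    by apply: is_cvg_nneseries => m _ _; exact: integral_ge0.
  apply: nearW => n.
  apply: (@le_trans _ _ (\sum_(0 <= m < n) (10 * C / m.+1%:R ^+ 2)%:E)%E).
    apply: lee_sum => m _.
    by have := expectation_block_energy_le Z2 ZC Z0 m; rewrite unlock.
  rewrite sumEFin lee_fin -mulr_sumr big_mkord.
  rewrite (_ : 20 * C = 10 * C * 2); last by ring.
  by rewrite ler_wpM2l ?mulr_ge0// sum_inv_sqr_le2.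
have iF : P.-integrable setT (fun w => \sum_(m <oo) F m w)%E.
  apply/integrableP; split.
    exact: ge0_emeasurable_sum.
  under eq_integral do rewrite gee0_abs ?nneseries_ge0//.
  by [].
have := integrable_ae measurableT iF.
apply: filterS => w /(_ I) Fw.
apply: (@average_cvg0 _ (Z ^~ w)); apply: cvg_series_cvg_0.
apply: nnseries_is_cvg; first by move=> m; exact: block_energy_ge0.
by rewrite ltey_eq Fw.
Qed.

(** * Gaussian moments *)

Section normal_moments.
Variable R : realType.
Local Notation mu := (@lebesgue_measure R).

(** The Radon-Nikodym derivative of the normal law and [normal_pdf] have the same integral over
    every measurable set, hence agree almost everywhere. *)
Lemma ge0_integral_normal_prob (m s : R) (f : R -> \bar R) :
    measurable_fun setT f -> (forall x, (0 <= f x)%E) ->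
  (\int[normal_prob m s]_x f x = \int[mu]_x (f x * (normal_pdf m s x)%:E))%E.
Proof.
move=> mf f0; have dom := @normal_prob_dominates R m s.
rewrite -(Radon_Nikodym_SigmaFinite.change_of_variables dom)//.
have mrn := measurable_int mu (Radon_Nikodym_SigmaFinite.f_integrable dom).
apply: ae_eq_integral => //.
- exact: emeasurable_funM.
- apply: emeasurable_funM => //; apply/measurable_EFinP.
  exact: measurable_normal_pdf.
apply: ae_eqe_mul2l; apply: integral_ae_eq => //.
- exact: Radon_Nikodym_SigmaFinite.f_integrable.
- by apply/measurable_EFinP; exact: measurable_normal_pdf.
- by move=> E _ mE; rewrite -(Radon_Nikodym_SigmaFinite.f_integral dom mE).
Qed.

(** Doubling the standard deviation gains a factor [expR t] with [t] proportional to [x^2], which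
    absorbs the polynomial [x^4]. The fourth moment is thereby dominated by a multiple of another
    normal density. *)
Lemma exp4_normal_pdf_le (s : R) : s != 0 -> exists K, forall x,
  x ^+ 4 * normal_pdf 0 s x <= K * normal_pdf 0 (2 * s) x.
Proof.
move=> s0; have s20 : 2 * s != 0 by rewrite mulf_neq0.
have p0 := normal_peak_gt0 s0; have p20 := normal_peak_gt0 s20.
(* With [t = 3 x^2 / (8 s^2)], the difference of the two exponents, [x^4 = 128/9 s^4 (t^2 / 2)], and
   [t^2 / 2 <= expR t]. The ratio of peaks corrects the normalisation. *)
exists (128 / 9 * s ^+ 4 * (normal_peak s / normal_peak (2 * s))) => x.
rewrite !normal_pdfE// /normal_fun !subr0.
set t := 3 * x ^+ 2 / (8 * s ^+ 2).
have t0 : 0 <= t by apply: divr_ge0; apply: mulr_ge0; rewrite ?sqr_ge0 ?ler0n.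
have -> : - x ^+ 2 / ((2 * s) ^+ 2 *+ 2) = - x ^+ 2 / (s ^+ 2 *+ 2) + t.
  by rewrite /t; field.
rewrite expRD; set e := expR _; set q := normal_peak s; set q2 := normal_peak _.
have -> : 128 / 9 * s ^+ 4 * (q / q2) * (q2 * (e * expR t)) =
    (128 / 9 * s ^+ 4 * expR t) * (q * e).
  by field; rewrite gt_eqF.
rewrite ler_wpM2r ?mulr_ge0 ?expR_ge0 ?(ltW p0)//.
have := @expR_ge1Dxn R t 1 t0; rewrite (_ : 2`! = 2)%N//.
move=> et; have {}et : t ^+ 2 / 2 <= expR t by apply: le_trans et; rewrite lerDr.
apply: (@le_trans _ _ (128 / 9 * s ^+ 4 * (t ^+ 2 / 2))).
  rewrite le_eqVlt; apply/orP; left; apply/eqP.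
  by rewrite /t; field.
by rewrite ler_wpM2l// mulr_ge0// exprn_even_ge0.
Qed.

Lemma normal_prob_moment4_lty (s : R) : s != 0 ->
  (\int[normal_prob 0 s]_x (x ^+ 4)%:E < +oo)%E.
Proof.
move=> s0; have [K le_K] := exp4_normal_pdf_le s0.
rewrite ge0_integral_normal_prob; last 2 first.
- by apply/measurable_EFinP; exact: measurable_funX.
- by move=> x; rewrite lee_fin exprn_even_ge0.
apply: (@le_lt_trans _ _ (\int[mu]_x (K%:E * (normal_pdf 0 (2 * s) x)%:E))%E).
  apply: ge0_le_integral => //.
  - by move=> x _; rewrite -EFinM lee_fin mulr_ge0 ?exprn_even_ge0 ?normal_pdf_ge0.
  - apply/measurable_EFinP/measurable_funM; last exact: measurable_normal_pdf.
    exact: measurable_funX.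
  - by apply/measurable_EFinP/measurable_funM => //; exact: measurable_normal_pdf.
  - by move=> x _; rewrite -!EFinM lee_fin.
rewrite integralZl//; last exact: integrable_normal_pdf.
by rewrite integral_normal_pdf mule1 ltry.
Qed.

Lemma expectation_law d (T : measurableType d) (P : probability T R)
    (m : {measure set (measurableTypeR R) -> \bar R}) (U : T -> R) (f : R -> R) :
    measurable_fun [set: T] U ->
    (forall B : set R, measurable B -> P (U @^-1` B) = m B) ->
    measurable_fun [set: R] f -> (forall x, 0 <= f x) ->
  ('E_P[(f \o U)%R] = \int[m]_x (f x)%:E)%E.
Proof.
move=> mU Um mf f0.
have mU' : @measurable_fun _ _ T (measurableTypeR R) setT U := mU.
pose U' : {mfun T >-> measurableTypeR R} := 
  HB.pack U (isMeasurableFun.Build _ _ T (measurableTypeR R) U mU').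
rewrite unlock.
rewrite -(ge0_integral_distribution (P := P) U' (f := EFin \o f))//.
- by apply: eq_measure_integral => B mB _; exact: Um.
- exact/measurable_EFinP.
Qed.

Lemma expectation_eq_law d (T : measurableType d) (P : probability T R)
    (U W : T -> R) (f : R -> R) :
    measurable_fun setT U -> measurable_fun setT W ->
    (forall B : set R, measurable B -> P (U @^-1` B) = P (W @^-1` B)) ->
    measurable_fun setT f -> (forall x, 0 <= f x) ->
  ('E_P[(f \o U)%R] = 'E_P[(f \o W)%R])%E.
Proof.
move=> mU mW UW mf f0.
have mW' : @measurable_fun _ _ T (measurableTypeR R) setT W := mW.
pose W' : {mfun T >-> measurableTypeR R} := 
  HB.pack W (isMeasurableFun.Build _ _ T (measurableTypeR R) W mW').
rewrite (expectation_law (m := distribution P W') mU)//.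
by rewrite (expectation_law (m := distribution P W') mW).
Qed.

(** [K] is chosen from [v] before the probability space and the variable, so a single constant
    serves all snapshots and all eigenvectors. *)
Lemma normal_law_moment4_bounded (v : R) : 0 <= v -> exists K : R,
  forall d (T : measurableType d) (P : probability T R) (U : T -> R),
    measurable_fun setT U ->
    (forall B : set R, measurable B -> P (U @^-1` B) = normal_law 0 v B) ->
  ('E_P[(fun w => U w ^+ 4)%R] <= K%:E)%E.
Proof.
move=> v0.
have mX4 : measurable_fun [set: R] (fun x : R => x ^+ 4) by exact: measurable_funX.
have X40 (x : R) : 0 <= x ^+ 4 by rewrite exprn_even_ge0.
rewrite /normal_law; have [_|vn0] := eqVneq v 0.
  exists 0 => d T P U mU UE.
  rewrite [leLHS](expectation_law (m := @dirac _ (measurableTypeR R) 0 R) mU UE mX4 X40).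
  rewrite integral_dirac//=; first by rewrite expr0n mule0.
  exact/measurable_EFinP.
have s0 : Num.sqrt v != 0 by rewrite gt_eqF// sqrtr_gt0 lt0r vn0.
exists (fine (\int[normal_prob 0 (Num.sqrt v)]_x (x ^+ 4)%:E)) => d T P U mU UE.
rewrite fineK.
  by rewrite [leLHS](expectation_law (m := normal_prob 0 (Num.sqrt v)) mU UE mX4 X40).
rewrite ge0_fin_numE ?normal_prob_moment4_lty//.
by apply: integral_ge0 => x _; rewrite lee_fin.
Qed.
End normal_moments.

(** * Reduction to the eigenbasis *)

Section diffusion.
Context (R : realType) (N : nat) (V L : 'M[R]_N) (lam : 'rV[R]_N).
Hypothesis V_orth : orthogonal_mx V.
Hypothesis L_eig : L = V *m diag_mx lam *m V^T.

(** The eigenvalue of the whole diffusion operator on the [i]-th column of [V]. *)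
Definition gain (T : nat) (alpha : nat -> R) (i : 'I_N) : R :=
  \prod_(t < T) (1 - alpha t * lam 0 i).

Lemma diffuse_eigenbasis T (alpha : nat -> R) (v : 'cV[R]_N) i :
  (V^T *m diffuse L T alpha v) i 0 = gain T alpha i * (V^T *m v) i 0.
Proof.
have [VtV _] := V_orth.
rewrite /diffuse /gain; elim: T v => [|T IH] v.
  by rewrite !big_ord0 mul1mx mul1r.
(* The last factor of the product acts first on [v]; the induction hypothesis is used at the vector
   it produces. *)
rewrite !big_ord_recr/= -mulmxA IH -mulrA; congr (_ * _).
rewrite mulmxA mulmxBr mulmx1 -scalemxAr L_eig !mulmxA VtV mul1mx.
rewrite mulmxBl -scalemxAl -mulmxA mul_diag_mx !mxE.
by ring.
Qed.

Lemma sample_covariance_eigenbasis (y : nat -> 'cV[R]_N) M i j :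
  (V^T *m sample_covariance y M *m V) i j =
  M%:R^-1 * \sum_(k < M) (V^T *m y k) i 0 * (V^T *m y k) j 0.
Proof.
rewrite /sample_covariance -scalemxAr -scalemxAl mxE mulmx_sumr mulmx_suml summxE.
congr (_ * _); apply: eq_bigr => k _.
have -> : V^T *m (y k *m (y k)^T) *m V = (V^T *m y k) *m (V^T *m y k)^T.
  by rewrite trmx_mul trmxK !mulmxA.
by rewrite mxE big_ord1 [X in _ * X]mxE.
Qed.
End diffusion.

Lemma measurable_linear_form (R : realType) (N : nat) (a : 'cV[R]_N) :
  measurable_fun [set: borel_cV R N] (fun v : borel_cV R N => (a^T *m v) 0 0).
Proof.
have mcoord j : measurable_fun [set: borel_cV R N] (fun v : borel_cV R N => v j 0).
  (* Open rays generate the Borel sets of the line, and their preimages under a continuous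
     coordinate are open. *)
  apply: (measurability _ (RGenOInfty.measurableE R)) => _ [_ [r ->] <-].
  rewrite setTI; apply: sub_sigma_algebra.
  apply: (@open_comp _ _ (fun v : 'cV[R]_N => v j 0)) => //.
  by move=> v _; exact: coord_continuous.
apply: (@eq_measurable_fun _ _ _ _ _ (fun v : borel_cV R N => \sum_j a j 0 * v j 0)).
  by move=> v _; rewrite mxE; apply: eq_bigr => j _; rewrite mxE.
by apply: measurable_sum => j; exact: measurable_funM.
Qed.

(** * Square integrability and polarisation *)

Section square_integrability.
Context d (T : measurableType d) (R : realType) (P : probability T R).
Implicit Types (X Y : T -> R).

Lemma Lfun2_expectation_sqr X : measurable_fun setT X ->
  ('E_P[(fun w => X w ^+ 2)%R] < +oo)%E -> X \in Lfun P 2.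
Proof.
move=> mX; rewrite unlock => X2; rewrite inE; apply/andP; split; first by rewrite inE.
rewrite inE/= /finite_norm unlock poweR_lty//=.
by under eq_integral => w _ do rewrite powR_mulrn// real_normK ?num_real//.
Qed.

Lemma expectation_sqrM_le X Y (c K : R) :
    measurable_fun setT X -> measurable_fun setT Y -> c ^+ 2 <= 1 ->
    ('E_P[(fun w => X w ^+ 4)%R] <= K%:E)%E ->
    ('E_P[(fun w => Y w ^+ 4)%R] <= K%:E)%E ->
  ('E_P[(fun w => (c * (X w * Y w)) ^+ 2)%R] <= (K + K)%:E)%E.
Proof.
move=> mX mY c1 XK YK.
have mX4 : measurable_fun setT (fun w => X w ^+ 4) by exact: measurable_funX.
have mY4 : measurable_fun setT (fun w => Y w ^+ 4) by exact: measurable_funX.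
apply: (@le_trans _ _ ('E_P[(fun w => X w ^+ 4 + Y w ^+ 4)%R])%E).
  apply: expectation_le.
  - by apply: measurable_funX; apply: measurable_funM => //; exact: measurable_funM.
  - exact: measurable_funD.
  - by move=> w; rewrite sqr_ge0.
  - by move=> w; rewrite addr_ge0// exprn_even_ge0.
  apply: aeW => w; rewrite exprMn.
  apply: (@le_trans _ _ ((X w * Y w) ^+ 2)); first by rewrite ler_piMl// sqr_ge0.
  rewrite -subr_ge0.
  (* A sum-of-squares certificate for [(X Y)^2 <= X^4 + Y^4]. *)
  have -> : X w ^+ 4 + Y w ^+ 4 - (X w * Y w) ^+ 2 =
      ((X w ^+ 2 - Y w ^+ 2) ^+ 2 + X w ^+ 4 + Y w ^+ 4) / 2 by field.
  by rewrite divr_ge0// !addr_ge0 ?sqr_ge0 ?exprn_even_ge0.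
move: XK YK; rewrite unlock => XK YK.
under eq_integral do rewrite EFinD.
rewrite ge0_integralD//.
- by rewrite EFinD leeD.
- by move=> w _; rewrite lee_fin exprn_even_ge0.
- exact/measurable_EFinP.
- by move=> w _; rewrite lee_fin exprn_even_ge0.
- exact/measurable_EFinP.
Qed.

Lemma Lfun2_moment4 X (K : R) : measurable_fun setT X ->
  ('E_P[(fun w => X w ^+ 4)%R] <= K%:E)%E -> X \in Lfun P 2.
Proof.
move=> mX XK; apply: Lfun2_expectation_sqr => //.
(* The product bound is applied with [Y = 1] and [c = 1]; [K'] bounds the fourth moments of both [X]
   and the constant 1. *)
pose K' := Num.max K 1.
apply: (@le_lt_trans _ _ (K' + K')%:E); last exact: ltry.
have XK' : ('E_P[(fun w => X w ^+ 4)%R] <= K'%:E)%E.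
  by apply: le_trans XK _; rewrite lee_fin le_max lexx.
have oneK' : ('E_P[(fun w => (cst 1 w : R) ^+ 4)%R] <= K'%:E)%E.
  rewrite (_ : (fun w => _) = cst 1); last by apply/funext => w /=; rewrite expr1n.
  by rewrite expectation_cst lee_fin le_max lexx orbT.
have c1 : (1 : R) ^+ 2 <= 1 by rewrite expr1n.
have m1 : measurable_fun [set: T] (cst (1 : R)) by [].
have := expectation_sqrM_le mX m1 c1 XK' oneK'.
rewrite (_ : (fun w => (1 * (X w * cst 1 w)) ^+ 2) = (fun w => X w ^+ 2))//.
by apply/funext => w; rewrite mul1r mulr1.
Qed.

(* Polarisation: [4 X Y = (X + Y)^2 - (X - Y)^2]. *)
Lemma expectationM_eq0_eq_law X Y : X \in Lfun P 2 -> Y \in Lfun P 2 ->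
    (forall B : set R, measurable B ->
      P ((X \+ Y) @^-1` B) = P ((X \- Y) @^-1` B)) ->
  ('E_P[X \* Y] = 0)%E.
Proof.
move=> X2 Y2 XY.
have mX : measurable_fun setT X by have := sub_Lfun_mfun X2; rewrite inE.
have mY : measurable_fun setT Y by have := sub_Lfun_mfun Y2; rewrite inE.
have iXY := Lfun2_mul_Lfun1 X2 Y2.
have D2 : X \- Y \in Lfun P 2.
  rewrite (_ : X \- Y = X \+ (-1) \o* Y); last by apply/funext => w /=; ring.
  by apply: Lfun2D => //; apply: Lfun_scale => //; rewrite ler1n.
have iDD := Lfun2_mul_Lfun1 D2 D2.
have msq : measurable_fun [set: R] (fun x : R => x * x) by exact: measurable_funM.
have sq0 (x : R) : 0 <= x * x by rewrite -expr2 sqr_ge0.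
have := expectation_eq_law (measurable_funD mX mY) (measurable_funB mX mY) XY msq sq0.
rewrite (_ : _ \o (X \+ Y) = ((X \- Y) \* (X \- Y)) \+ 4 \o* (X \* Y)); last first.
  by apply/funext => w /=; ring.
rewrite expectationD//; last exact: Lfun_scale.
rewrite expectationZl//.
(* Both expectations are finite, so the common second moment can be cancelled in [R]. *)
rewrite -(fineK (expectation_fin_num iDD)) -(fineK (expectation_fin_num iXY)).
by rewrite -EFinM -EFinD => -[] h; congr EFin; lra.
Qed.
End square_integrability.

(** * Linear forms of an isotropic Gaussian vector *)

Section normal_forms.
Context d (T : measurableType d) (R : realType) (P : probability T R).
Context (N : nat) (s : R) (X : T -> 'cV[R]_N).
Hypothesis X_normal : multivariate_normal P 0 s%:M X.

Lemma measurable_normal_form (a : 'cV[R]_N) :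
  measurable_fun setT (fun w => (a^T *m X w) 0 0).
Proof.
have [mX _] := X_normal.
exact: (measurableT_comp (measurable_linear_form a) mX).
Qed.

Lemma normal_form_law (a : 'cV[R]_N) (B : set R) : measurable B ->
  P ((fun w => (a^T *m X w) 0 0) @^-1` B) = normal_law 0 (s * (a^T *m a) 0 0) B.
Proof.
have [_ lawX] := X_normal => mB.
have := lawX a B mB.
by rewrite mulmx0 mxE mul_mx_scalar -scalemxAl mxE.
Qed.

(** For orthogonal [a] and [b], the vectors [a + b] and [a - b] have the same norm, so their linear
    forms have the same centred normal law. Only one-dimensional laws enter, as in the definition of
    [multivariate_normal]. *)
Lemma normal_form_law_orthogonal (a b : 'cV[R]_N) (B : set R) :
    (a^T *m b) 0 0 = 0 -> measurable B ->
  P ((fun w => (a^T *m X w) 0 0 + (b^T *m X w) 0 0) @^-1` B) =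
  P ((fun w => (a^T *m X w) 0 0 - (b^T *m X w) 0 0) @^-1` B).
Proof.
move=> ab mB.
have ba : (b^T *m a) 0 0 = 0.
  by rewrite -[b^T *m a]trmxK trmx_mul trmxK mxE ab.
have mxD (u v : 'M[R]_1) : (u + v) 0 0 = u 0 0 + v 0 0 by rewrite mxE.
have mxN (u : 'M[R]_1) : (- u) 0 0 = - u 0 0 by rewrite mxE.
have -> : (fun w => (a^T *m X w) 0 0 + (b^T *m X w) 0 0) =
    (fun w => ((a + b)^T *m X w) 0 0).
  by apply/funext => w; rewrite linearD mulmxDl mxD.
have -> : (fun w => (a^T *m X w) 0 0 - (b^T *m X w) 0 0) =
    (fun w => ((a - b)^T *m X w) 0 0).
  by apply/funext => w; rewrite raddfB mulmxBl mxD mxN.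
rewrite (normal_form_law (a + b) mB) (normal_form_law (a - b) mB).
suff -> : ((a - b)^T *m (a - b)) 0 0 = ((a + b)^T *m (a + b)) 0 0 by [].
have trD : (a + b)^T = a^T + b^T by rewrite raddfD.
have trB : (a - b)^T = a^T - b^T by rewrite raddfB.
rewrite trD trB !mulmxDl !mulmxDr !mulNmx !mulmxN opprK.
by rewrite !mxD !mxN ab ba; ring.
Qed.
End normal_forms.

(** * Convergence of the off-diagonal entries *)

Theorem proposition1 (R : realType) (n : nat) (G : network R n.+1)
  (V : 'M[R]_n.+1) (lam : 'rV[R]_n.+1)
  (V_orth : orthogonal_mx V)
  (L_eig : laplacian G = V *m diag_mx lam *m V^T)
  (lam_first : lam 0 ord0 = 0)
  (lam_incr : forall i j : 'I_n.+1, (i < j)%N -> lam 0 i < lam 0 j)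
  (T : nat -> nat) (T_gt0 : forall k, (0 < T k)%N)
  (alpha : nat -> nat -> R)
  (alpha_bounds : forall k t, (t < T k)%N ->
     0 < alpha k t < (lam 0 ord_max)^-1)
  (d : measure_display) (Omega : measurableType d) (P : probability Omega R)
  (sigma : R) (x : nat -> Omega -> 'cV[R]_n.+1)
  (x_indep : mutually_independent P (x : nat -> Omega -> borel_cV R n.+1))
  (x_normal : forall k, multivariate_normal P 0 ((sigma ^+ 2)%:M) (x k)) :
  let y k w := diffuse (laplacian G) (T k) (alpha k) (x k w) in
  let S M w := sample_covariance (y ^~ w) M in
  let B M w := V^T *m S M w *m V in
  forall i j : 'I_n.+1, i != j ->
    {ae P, forall w, (fun M => B M w i j) @ \oo --> (0 : R)}.
Proof.
move=> y S B i j ij.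
have [VtV _] := V_orth.
pose u m k w := ((col m V)^T *m x k w) 0 0.
have u_def m k w : (V^T *m x k w) m 0 = u m k w.
  by rewrite /u tr_col -row_mul [RHS]mxE.
pose c k := gain lam (T k) (alpha k) i * gain lam (T k) (alpha k) j.
pose f k (v : borel_cV R n.+1) :=
  c k * (((col i V)^T *m v) 0 0 * ((col j V)^T *m v) 0 0).
pose Z k w := c k * (u i k w * u j k w).
have BE M w : B M w i j = M%:R^-1 * \sum_(k < M) Z k w.
  rewrite /B /S sample_covariance_eigenbasis; congr (_ * _).
  apply: eq_bigr => k _.
  by rewrite /y !(diffuse_eigenbasis V_orth L_eig) !u_def mulrACA.
have lam_ge0 m : 0 <= lam 0 m.
  case: (posnP m) => [m0|m0]; last by rewrite -lam_first ltW// lam_incr.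
  by rewrite (_ : m = ord0) ?lam_first//; exact: val_inj.
have lam_le m : lam 0 m <= lam 0 ord_max.
  have := leq_ord m; rewrite leq_eqVlt => /orP[/eqP m_max|m_lt].
    by rewrite (_ : m = ord_max)//; exact: val_inj.
  by rewrite ltW// lam_incr.
have gain01 k m : 0 <= gain lam (T k) (alpha k) m <= 1.
  rewrite /gain; elim/big_ind: _ => //.
  - by rewrite ler01 lexx.
  - by move=> a b /andP[a0 a1] /andP[b0 b1]; rewrite mulr_ge0// mulr_ile1.
  move=> t _; have /andP[al0 al1] := alpha_bounds k t (ltn_ord t).
  have al_lam0 : 0 <= alpha k t * lam 0 m by rewrite mulr_ge0// ltW.
  rewrite subr_ge0 gerBl al_lam0 andbT.
  (* Positivity is read off from [0 < alpha k t < (lam 0 ord_max)^-1], which also excludes a zero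
     eigenvalue because [0^-1 = 0]. *)
  have lmax0 : 0 < lam 0 ord_max by rewrite -invr_gt0 (lt_trans al0).
  rewrite -(mulVf (lt0r_neq0 lmax0)).
  by apply: ler_pM => //; exact: ltW.
have c1 k : c k ^+ 2 <= 1.
  have /andP[gi0 gi1] := gain01 k i; have /andP[gj0 gj1] := gain01 k j.
  by rewrite expr_le1 ?mulr_ge0// mulr_ile1.
have col_dot a b : ((col a V)^T *m col b V) 0 0 = (a == b)%:R.
  transitivity ((V^T *m V) a b); last by rewrite VtV mxE.
  by rewrite !mxE; apply: eq_bigr => k _; rewrite !mxE.
have mu_ m k : measurable_fun setT (u m k) by exact: measurable_normal_form.
(* The factor 1 is the squared norm of a column of [V], kept so that the variance matches the form
   given by [normal_form_law]. *)
have var_ge0 : 0 <= sigma ^+ 2 * 1 by rewrite mulr1 sqr_ge0.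
have [K le_K] := normal_law_moment4_bounded var_ge0.
have u4 m k : ('E_P[(fun w => u m k w ^+ 4)%R] <= K%:E)%E.
  apply: le_K => // B' mB'.
  by rewrite (normal_form_law (x_normal k) (col m V) mB') col_dot eqxx.
have u2 m k : u m k \in Lfun P 2 by exact: Lfun2_moment4 (u4 m k).
have mZ k : measurable_fun setT (Z k).
  by apply: measurable_funM => //; exact: measurable_funM.
have ZK k : ('E_P[(fun w => Z k w ^+ 2)%R] <= (K + K)%:E)%E.
  exact: expectation_sqrM_le.
have Z2 k : Z k \in Lfun P 2.
  by apply: Lfun2_expectation_sqr => //; apply: le_lt_trans (ZK k) _; exact: ltry.
have Z1 k : Z k \in Lfun P 1 by apply: Lfun_subset12 (Z2 k); rewrite fin_num_measure.
have EZ k : ('E_P[Z k] = 0)%E.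
  rewrite (_ : Z k = c k \o* (u i k \* u j k)); last first.
    by apply/funext => w /=; rewrite mulrC.
  rewrite expectationZl ?Lfun2_mul_Lfun1// expectationM_eq0_eq_law ?mule0//.
  move=> B' mB'; apply: (normal_form_law_orthogonal (x_normal k)) => //.
  by rewrite col_dot (negbTE ij).
have EZZ k l : k != l -> ('E_P[Z k \* Z l] = 0)%E.
  move=> kl.
  have mx m : @measurable_fun _ _ Omega (borel_cV R n.+1) setT (x m).
    by have [] := x_normal m.
  pose X m : {mfun Omega >-> borel_cV R n.+1} :=
    HB.pack (x m) (isMeasurableFun.Build _ _ Omega (borel_cV R n.+1) (x m) (mx m)).
  have mf m : measurable_fun setT (f m).
    apply: measurable_funM => //.
    by apply: measurable_funM; exact: measurable_linear_form.
  (* Each [Z k] is a function of the vector [x k] alone, so independence of the inputs factors the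
     expectation into two zero means. *)
  have -> : 'E_P[Z k \* Z l]%E = 'E_P[(f k \o X k) \* (f l \o X l)]%E by [].
  rewrite expectationM_indep//; first by rewrite [X in (X * _)%E]EZ mul0e.
  - by move=> A' B' mA' mB'; exact: (mutually_independent_pair x_indep).
  - exact: Z1.
  - exact: Z1.
  - exact: (Lfun2_mul_Lfun1 (Z2 k) (Z2 l)).
have ZZK k : ('E_P[Z k \* Z k] <= (K + K)%:E)%E.
  by rewrite (_ : Z k \* Z k = fun w => Z k w ^+ 2).
have := rajchman_slln Z2 ZZK EZZ.
by apply: filterS => w; under eq_fun do rewrite -BE.
Qed.
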